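(* Let $S=\Bbbk[x_1,x_2,x_3,x_4]$ and let $I=(f_1,f_2,f_3,f_4)$ be an ideal generated by a homogeneous regular sequence with $\deg f_i=a_i$, where $a_1\le a_2\le a_3\le a_4$. If $a_4\gg0$, then the decomposition of $\beta(S/I)$ obtained from the Boij–Söderberg algorithm is completely determined by the degrees $a_1,a_2,a_3,a_4$. In particular, it is given as follows, by cases (terms with the same degree sequence being combined and zero terms dropped). Case 1: $a_1<a_2\le a_3$ or $a_1=a_2=a_3$. When $$a_4>\max\left\{a_1+a_2+a_3,\ \rho_1,\rho_2,\rho_3,\rho_4,\rho_5\right\},$$ with $\rho_1,\dots,\rho_5$ the expressions given in the context (where, if $a_1\le a_2=a_3$, this maximum is to be read as $a_1+2a_2$), one has $\beta(S/I)=\sum_{s=1}^{12}y_s\pi(\mathbf e^s)$, where $$\begin{aligned} y_1=y_{12}&=a_1a_2(a_2+a_3)(a_2+a_3+a_4),\\ y_2=y_{11}&=-a_1a_2(a_1a_2+2a_1a_3-a_3^2+a_1a_4-a_3a_4),\\ y_3=y_{10}&=a_1a_2(a_1-a_2+a_3)(a_1+a_2+4a_3+2a_4),\\ y_4=y_9&=-a_1a_2(a_1^2+4a_1a_3-a_2a_3+a_1a_4-a_3a_4),\\ y_5=y_8&=a_1a_2(a_1a_2-5a_1a_3+a_2a_4+a_3a_4),\\ y_6=y_7&=6a_1a_2a_3(a_1-a_3+a_4), \end{aligned}$$ and, writing $t=a_1+a_2+a_3+a_4$, $$\begin{aligned} \mathbf e^1&=(0,a_1,a_1+a_2,a_1+a_2+a_3,t),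 & \mathbf e^2&=(0,a_2,a_1+a_2,a_1+a_2+a_3,t),\\ \mathbf e^3&=(0,a_2,a_1+a_3,a_1+a_2+a_3,t), & \mathbf e^4&=(0,a_3,a_1+a_3,a_1+a_2+a_3,t),\\ \mathbf e^5&=(0,a_3,a_2+a_3,a_1+a_2+a_3,t), & \mathbf e^6&=(0,a_3,a_2+a_3,a_1+a_2+a_4,t),\\ \mathbf e^7&=(0,a_3,a_1+a_4,a_1+a_2+a_4,t), & \mathbf e^8&=(0,a_4,a_1+a_4,a_1+a_2+a_4,t),\\ \mathbf e^9&=(0,a_4,a_2+a_4,a_1+a_2+a_4,t), & \mathbf e^{10}&=(0,a_4,a_2+a_4,a_1+a_3+a_4,t),\\ \mathbf e^{11}&=(0,a_4,a_3+a_4,a_1+a_3+a_4,t), & \mathbf e^{12}&=(0,a_4,a_3+a_4,a_2+a_3+a_4,t). \end{aligned}$$ Case 2: $a_1=a_2<a_3$ and $a_4\ge\max\{2a_1+a_3,4a_1\}$. Then $\beta(S/I)=\sum_{s=1}^{8}y_s\pi(\mathbf e^s)$, where $$\begin{aligned} y_1=y_8&=2a_1^2a_3(a_3+a_4), & y_2=y_7&=2a_1^2a_3(a_1+2a_3+a_4),\\ y_3=y_6&=-2a_1^2a_3(4a_1-a_4), & y_4=y_5&=6a_1^2a_3(a_1-a_3+a_4), \end{aligned}$$ and, writing $t=2a_1+a_3+a_4$, $$\begin{aligned} \mathbf e^1&=(0,a_1,2a_1,2a_1+a_3,t), & \mathbf e^2&=(0,a_1,a_1+a_3,2a_1+a_3,t),\\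 \mathbf e^3&=(0,a_3,a_1+a_3,2a_1+a_3,t), & \mathbf e^4&=(0,a_3,a_1+a_3,2a_1+a_4,t),\\ \mathbf e^5&=(0,a_3,a_1+a_4,2a_1+a_4,t), & \mathbf e^6&=(0,a_4,a_1+a_4,2a_1+a_4,t),\\ \mathbf e^7&=(0,a_4,a_1+a_4,a_1+a_3+a_4,t), & \mathbf e^8&=(0,a_4,a_3+a_4,a_1+a_3+a_4,t). \end{aligned}$$
   Context: $\Bbbk$ is a field, $S$ is standard graded, the $a_i$ are positive integers, and $\beta(S/I)=(\beta_{i,j})$ is the graded Betti diagram; $\beta_{i,j}(S/I)$ is the number of $i$-element subsets $T\subseteq\{1,2,3,4\}$ with $\sum_{t\in T}a_t=j$. A degree sequence is a strictly increasing integer sequence $\mathbf d=(d_0,\dots,d_m)$, and $\pi(\mathbf d)$ is the diagram with $\pi(\mathbf d)_{i,d_i}=\prod_{k\neq i}\frac1{|d_i-d_k|}$ and all other entries $0$. Boij–Söderberg algorithm. Starting with $\beta=\beta(S/I)$, repeat: let $\mathbf d$ be the minimal degree sequence, $d_i=\min\{j:\beta_{i,j}\ne0\}$; let $q>0$ be the maximal rational such that $\beta-q\pi(\mathbf d)$ has nonnegative entries; replace $\beta$ by $\beta-q\pi(\mathbf d)$; stop when $\beta=0$. The output is the expression of $\beta(S/I)$ as the sum of the diagrams $q\pi(\mathbf d)$ so obtained; it is the unique positive rational combination of pure diagrams $\pi(\mathbf d)$ whose degree sequences form a chain in the termwise order. The quantities $\rho_1,\dots,\rho_5$ in Case 1 are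 defined, for $a_1<a_2<a_3$, by $$\rho_1=-(a_2+a_3),\qquad \rho_2=\frac{a_1(a_2+2a_3)-a_3^2}{a_3-a_1},\qquad \rho_3=\frac{a_3(a_2+a_3)-a_1(a_1+3a_3)}{2a_1},$$ $$\rho_4=\frac{a_1(a_1+4a_3)-a_2(a_1+2a_3)}{a_3-a_1},\qquad \rho_5=\frac{a_2(5a_1a_3+a_2^2)-(a_1a_2^2+a_1^2a_3+a_1a_3^2+a_2a_3^2)}{a_2(a_2+a_3)}.$$
   Formalization: In Case 1 with a_1<a_2<a_3, the sum under the printed bound is claimed to be the algorithm's output only if also y_4≥0 (it fails for degrees 2,3,4,10, where y_4=-24); the identity β(S/I)=Σ y_s π(e^s) and the a_4≫0 claim hold without this condition. *)

(* Defs.v *)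
From Stdlib Require Import ClassicalEpsilon.
From HB Require Import structures.
From mathcomp Require Import all_boot all_order all_algebra.
From mathcomp Require Import mpoly.

Set Implicit Arguments.
Unset Strict Implicit.
Unset Printing Implicit Defensive.

Import Order.TTheory GRing.Theory Num.Theory.
Local Open Scope ring_scope.

Definition ideal_gen (R : comNzRingType) (s : seq R) (g : R) : Prop :=
  exists c : nat -> R, g = \sum_(j < size s) c j * s`_j.

Definition regular_sequence (R : comNzRingType) (s : seq R) : Prop :=
  (forall (i : nat) (g : R), (i < size s)%N ->
     ideal_gen (take i s) (g * s`_i) -> ideal_gen (take i s) g)
  /\ ~ ideal_gen s 1.

Definition homog_int (n : nat) (k : fieldType) (z : int) (p : {mpoly k[n]}) :
  Prop :=
  match z with
  | Posz d => p \is d.-homog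
  | Negz _ => p = 0
  end.

(* A graded free resolution of S/I, where S = k[x_1..x_n] and the ideal I is
   given as a predicate.  The i-th free module is the direct sum of the
   S(- res_shift i l), 'I_(res_rank i) indexing its basis; its elements are row
   vectors, so that the differential is u |-> u *m res_diff i.  The
   augmentation sends u to the class of u *m res_aug modulo I. *)
Record graded_resolution (n : nat) (k : fieldType) (I : {mpoly k[n]} -> Prop) :=
  GradedResolution {
    res_rank : nat -> nat;
    res_shift : forall i, 'I_(res_rank i) -> int;
    res_diff : forall i, 'M[{mpoly k[n]}]_(res_rank i.+1, res_rank i);
    res_aug : 'cV[{mpoly k[n]}]_(res_rank 0);
    res_diff_homog : forall i (u : 'I_(res_rank i.+1)) (v : 'I_(res_rank i)),
      homog_int (res_shift u - res_shift v) (res_diff i u v);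
    res_aug_homog : forall u : 'I_(res_rank 0),
      homog_int (res_shift u) (res_aug u 0);
    res_aug_surj : exists u : 'rV_(res_rank 0), I (1 - (u *m res_aug) 0 0);
    res_exact0 : forall u : 'rV_(res_rank 0),
      I ((u *m res_aug) 0 0) <-> exists v, u = v *m res_diff 0;
    res_exactS : forall i (u : 'rV_(res_rank i.+1)),
      u *m res_diff i = 0 <-> exists v, u = v *m res_diff i.+1
  }.

(* All entries of the differentials lie in the ideal (x_1, ..., x_n). *)
Definition minimal_resolution (n : nat) (k : fieldType)
    (I : {mpoly k[n]} -> Prop) (F : graded_resolution I) : Prop :=
  forall i (u : 'I_(res_rank F i.+1)) (v : 'I_(res_rank F i)),
    (res_diff F i u v)@_0%MM = 0.

Definition is_betti (n : nat) (k : fieldType) (I : {mpoly k[n]} -> Prop)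
    (b : nat -> int -> nat) : Prop :=
  exists F : graded_resolution I, minimal_resolution F /\
    forall (i : nat) (j : int),
      b i j = #|[set l : 'I_(res_rank F i) | res_shift l == j]|.

(* The graded Betti numbers of S/I, read off a minimal graded free resolution. *)
Definition betti (n : nat) (k : fieldType) (I : {mpoly k[n]} -> Prop) :
  nat -> int -> nat :=
  epsilon (inhabits (fun _ _ => 0%N)) (is_betti I).

Definition diagram := nat -> int -> rat.

Definition betti_diagram (n : nat) (k : fieldType) (I : {mpoly k[n]} -> Prop) :
  diagram := fun i j => (betti I i j)%:R.

(* A degree sequence (d_0, ..., d_m) is a list of size m + 1. *)
Definition degree_sequence (d : seq int) : bool := sorted <%R d.

Definition pure (d : seq int) : diagram := fun i j =>
  if (i < size d)%N && (j == d`_i) then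
    \prod_(l < size d | l != i :> nat) (`|d`_i - d`_l|%:~R)^-1
  else 0.

Definition decomposition := seq (rat * seq int).

Definition decomposes (b : diagram) (L : decomposition) : Prop :=
  forall i j, b i j = \sum_(t <- L) t.1 * pure t.2 i j.

Definition sub_pure (b : diagram) (q : rat) (d : seq int) : diagram :=
  fun i j => b i j - q * pure d i j.

Definition nonneg_diagram (b : diagram) : Prop := forall i j, 0 <= b i j.

Definition minimal_degrees (b : diagram) (d : seq int) : Prop :=
  [/\ degree_sequence d,
      forall i, (i < size d)%N ->
        b i d`_i <> 0 /\ (forall j, b i j <> 0 -> d`_i <= j)
    & forall i j, (size d <= i)%N -> b i j = 0].

Definition maximal_coefficient (b : diagram) (d : seq int) (q : rat) : Prop :=
  nonneg_diagram (sub_pure b q d) /\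
  forall q', nonneg_diagram (sub_pure b q' d) -> q' <= q.

(* boij_soderberg b L: run on b, the algorithm terminates and successively
   produces the terms of L. *)
Inductive boij_soderberg : diagram -> decomposition -> Prop :=
| BS_stop b : (forall i j, b i j = 0) -> boij_soderberg b [::]
| BS_step b q d L :
    minimal_degrees b d -> 0 < q -> maximal_coefficient b d q ->
    boij_soderberg (sub_pure b q d) L ->
    boij_soderberg b ((q, d) :: L).

(* Combine the terms with the same degree sequence, drop the zero terms. *)
Definition collect (L : decomposition) : decomposition :=
  [seq t <- [seq (\sum_(u <- L | u.2 == d) u.1, d) | d <- undup (unzip2 L)]
     | t.1 != 0].

Definition rho1 (a1 a2 a3 : rat) : rat := - (a2 + a3).
Definition rho2 (a1 a2 a3 : rat) : rat :=
  (a1 * (a2 + 2 * a3) - a3 ^+ 2) / (a3 - a1).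
Definition rho3 (a1 a2 a3 : rat) : rat :=
  (a3 * (a2 + a3) - a1 * (a1 + 3 * a3)) / (2 * a1).
Definition rho4 (a1 a2 a3 : rat) : rat :=
  (a1 * (a1 + 4 * a3) - a2 * (a1 + 2 * a3)) / (a3 - a1).
Definition rho5 (a1 a2 a3 : rat) : rat :=
  (a2 * (5 * a1 * a3 + a2 ^+ 2)
   - (a1 * a2 ^+ 2 + a1 ^+ 2 * a3 + a1 * a3 ^+ 2 + a2 * a3 ^+ 2))
  / (a2 * (a2 + a3)).

Definition case1_threshold (a1 a2 a3 : rat) : rat :=
  if a2 == a3 then a1 + 2 * a2 else
  foldr Num.max (a1 + a2 + a3)
    [:: rho1 a1 a2 a3; rho2 a1 a2 a3; rho3 a1 a2 a3; rho4 a1 a2 a3;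
        rho5 a1 a2 a3].

(* For a1 < a2 < a3 this coefficient may be negative above case1_threshold: for
   (a1, a2, a3, a4) = (2, 3, 4, 10) the threshold is 9 and case1_y4 = -24.  The
   twelve terms then still add up to the Betti diagram, but they are not the
   output of the algorithm, whose coefficients are positive. *)
Definition case1_y4 (a1 a2 a3 a4 : rat) : rat :=
  - (a1 * a2 * (a1 ^+ 2 + 4 * a1 * a3 - a2 * a3 + a1 * a4 - a3 * a4)).

Definition case1_coefs (a1 a2 a3 a4 : rat) : seq rat :=
  let y :=
    [:: a1 * a2 * (a2 + a3) * (a2 + a3 + a4);
        - (a1 * a2 * (a1 * a2 + 2 * a1 * a3 - a3 ^+ 2 + a1 * a4 - a3 * a4));
        a1 * a2 * (a1 - a2 + a3) * (a1 + a2 + 4 * a3 + 2 * a4);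
        case1_y4 a1 a2 a3 a4;
        a1 * a2 * (a1 * a2 - 5 * a1 * a3 + a2 * a4 + a3 * a4);
        6 * a1 * a2 * a3 * (a1 - a3 + a4)] in
  y ++ rev y.

Definition case1_degrees (a1 a2 a3 a4 : int) : seq (seq int) :=
  let t := a1 + a2 + a3 + a4 in
  [:: [:: 0; a1; a1 + a2; a1 + a2 + a3; t];
      [:: 0; a2; a1 + a2; a1 + a2 + a3; t];
      [:: 0; a2; a1 + a3; a1 + a2 + a3; t];
      [:: 0; a3; a1 + a3; a1 + a2 + a3; t];
      [:: 0; a3; a2 + a3; a1 + a2 + a3; t];
      [:: 0; a3; a2 + a3; a1 + a2 + a4; t];
      [:: 0; a3; a1 + a4; a1 + a2 + a4; t];
      [:: 0; a4; a1 + a4; a1 + a2 + a4; t];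
      [:: 0; a4; a2 + a4; a1 + a2 + a4; t];
      [:: 0; a4; a2 + a4; a1 + a3 + a4; t];
      [:: 0; a4; a3 + a4; a1 + a3 + a4; t];
      [:: 0; a4; a3 + a4; a2 + a3 + a4; t]].

Definition case1_terms (a1 a2 a3 a4 : nat) : decomposition :=
  zip (case1_coefs a1%:R a2%:R a3%:R a4%:R) (case1_degrees a1 a2 a3 a4).

Definition case2_coefs (a1 a3 a4 : rat) : seq rat :=
  let y :=
    [:: 2 * a1 ^+ 2 * a3 * (a3 + a4);
        2 * a1 ^+ 2 * a3 * (a1 + 2 * a3 + a4);
        - (2 * a1 ^+ 2 * a3 * (4 * a1 - a4));
        6 * a1 ^+ 2 * a3 * (a1 - a3 + a4)] in
  y ++ rev y.

Definition case2_degrees (a1 a3 a4 : int) : seq (seq int) :=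
  let t := 2 * a1 + a3 + a4 in
  [:: [:: 0; a1; 2 * a1; 2 * a1 + a3; t];
      [:: 0; a1; a1 + a3; 2 * a1 + a3; t];
      [:: 0; a3; a1 + a3; 2 * a1 + a3; t];
      [:: 0; a3; a1 + a3; 2 * a1 + a4; t];
      [:: 0; a3; a1 + a4; 2 * a1 + a4; t];
      [:: 0; a4; a1 + a4; 2 * a1 + a4; t];
      [:: 0; a4; a1 + a4; a1 + a3 + a4; t];
      [:: 0; a4; a3 + a4; a1 + a3 + a4; t]].

Definition case2_terms (a1 a3 a4 : nat) : decomposition :=
  zip (case2_coefs a1%:R a3%:R a4%:R) (case2_degrees a1 a3 a4).

Definition in_case1 (a1 a2 a3 : nat) : Prop :=
  (a1 < a2 /\ a2 <= a3)%N \/ (a1 = a2 /\ a2 = a3).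

Definition in_case2 (a1 a2 a3 : nat) : Prop := a1 = a2 /\ (a2 < a3)%N.

Definition complete_intersection (k : fieldType) (a1 a2 a3 a4 : nat)
    (f1 f2 f3 f4 : {mpoly k[4]}) : Prop :=
  [/\ f1 \is a1.-homog, f2 \is a2.-homog, f3 \is a3.-homog, f4 \is a4.-homog
    & regular_sequence [:: f1; f2; f3; f4]].

(* Main.v *)
From Stdlib Require Import ClassicalEpsilon.
Require Import Defs.
From mathcomp Require Import all_boot all_order all_algebra.
From mathcomp Require Import mpoly.
From mathcomp Require Import zify ring lra.

(** The Betti numbers of [S/I] are those of the Koszul complex.  It is built one
   generator at a time: if [f] is a nonzerodivisor on [S/I], the mapping cone of
   multiplication by [f] on a minimal free resolution of [S/I] is a minimal free
   resolution of [S/(I + f)].  Every minimal resolution has the same Betti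
   numbers, since a graded chain map [F -> G -> F] over the identity of [S/I] is
   the identity modulo [(x_1, ..., x_n)], and graded maps have block-diagonal
   reductions.

   Conversely, a combination of pure diagrams with positive coefficients whose
   degree sequences form a chain is necessarily the output of the algorithm: two
   consecutive degree sequences [d < d'] differ at some [i], the entry at
   [(i, d_i)] comes from the term of [d] alone, and so it bounds the coefficient
   that can be subtracted.  It remains to check the rational identities, and that
   the coefficients obtained after merging equal degree sequences are
   nonnegative. *)

Set Implicit Arguments.
Unset Strict Implicit.
Unset Printing Implicit Defensive.

Import Order.TTheory GRing.Theory Num.Theory.
Local Open Scope ring_scope.

(** * Homogeneous components *)

Section Homogeneous.
Variables (n : nat) (k : fieldType).
Implicit Types (p q : {mpoly k[n]}) (z w : int).

(** Indexed by integers because differences of shifts may be negative; a component of negative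
    degree is 0, in agreement with [homog_int]. *)
Definition hcomp z p : {mpoly k[n]} :=
  if z is Posz d then pihomog mdeg d p else 0.

Lemma hcompD z p q : hcomp z (p + q) = hcomp z p + hcomp z q.
Proof. by case: z => d /=; rewrite ?pihomogD ?addr0. Qed.

Lemma hcomp0 z : hcomp z 0 = 0.
Proof. by case: z => d //=; rewrite pihomog0. Qed.

Lemma hcompN z p : hcomp z (- p) = - hcomp z p.
Proof. by case: z => d /=; rewrite ?pihomogN ?oppr0. Qed.

Lemma hcomp_sum z (I : Type) (r : seq I) (P : pred I) (F : I -> {mpoly k[n]}) :
  hcomp z (\sum_(i <- r | P i) F i) = \sum_(i <- r | P i) hcomp z (F i).
Proof. exact: (big_morph (hcomp z) (hcompD z) (hcomp0 z)). Qed.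

Lemma homog_int0 z : homog_int z (0 : {mpoly k[n]}).
Proof. by case: z => d //=; exact: dhomog0. Qed.

Lemma hcomp_homog z p : homog_int z (hcomp z p).
Proof. by case: z => d //=; exact: pihomogP. Qed.

Lemma hcomp_dhomog z d p : p \is d.-homog -> hcomp z p = if z == d then p else 0.
Proof.
case: z => e //= hp; rewrite eqz_nat; case: eqP => [->|/eqP ne].
  exact: pihomog_dE.
by apply: pihomog_ne0 hp; rewrite eq_sym.
Qed.

Lemma hcomp_id z p : homog_int z p -> hcomp z p = p.
Proof.
case: z => d /=; last by move=> ->.
by move=> hp; apply: pihomog_dE.
Qed.

(** Split [p] into components: each one times [q] is homogeneous of degree raised by [w], and since
    adding [w] is injective on integers the same component survives on both sides. *)
Lemma hcompM z w p q : homog_int w q -> hcomp (z + w) (p * q) = hcomp z p * q.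
Proof.
case: w => [e|e] /=; last by move=> ->; rewrite !mulr0 hcomp0.
move=> hq.
have {1 2}-> := pihomog_partitionE (leqnn (mmeasure mdeg p)).
rewrite mulr_suml !hcomp_sum mulr_suml; apply: eq_bigr => d _.
have hd := pihomogP mdeg d p.
rewrite (hcomp_dhomog _ (dhomogM hd hq)) (hcomp_dhomog _ hd) PoszD.
by rewrite (inj_eq (addIr _)); case: ifP => //; rewrite mul0r.
Qed.

Lemma homog_intN z p : homog_int z p -> homog_int z (- p).
Proof. by move=> hp; rewrite -(hcomp_id hp) -hcompN; apply: hcomp_homog. Qed.

Lemma homog_int_const z p : homog_int z p -> z != 0 -> p@_0%MM = 0.
Proof.
case: z => d /=; last by move=> ->; rewrite mcoeff0.
by move=> hp nz; apply: dhomog_nemf_coeff hp _; rewrite mf0 eq_sym.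
Qed.

Definition graded_mx r c (s : 'I_r -> int) (t : 'I_c -> int)
    (A : 'M[{mpoly k[n]}]_(r, c)) :=
  forall i j, homog_int (s i - t j) (A i j).

(** The projection onto degree-preserving maps between free modules with shifts [s] and [t]. It
    turns any solution of a linear equation with graded data into a graded one. *)
Definition hmx r c (s : 'I_r -> int) (t : 'I_c -> int)
    (A : 'M[{mpoly k[n]}]_(r, c)) : 'M[{mpoly k[n]}]_(r, c) :=
  \matrix_(i, j) hcomp (s i - t j) (A i j).

Lemma hmx_graded r c s t (A : 'M_(r, c)) : graded_mx s t (hmx s t A).
Proof. by move=> i j; rewrite mxE; apply: hcomp_homog. Qed.

Lemma hmx_id r c s t (A : 'M_(r, c)) : graded_mx s t A -> hmx s t A = A.
Proof. by move=> hA; apply/matrixP => i j; rewrite mxE hcomp_id. Qed.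

Lemma hmxM r c m s t u (A : 'M_(r, c)) (B : 'M_(c, m)) :
  graded_mx t u B -> hmx s u (A *m B) = hmx s t A *m B.
Proof.
move=> hB; apply/matrixP => i j; rewrite !mxE hcomp_sum; apply: eq_bigr => l _.
by rewrite mxE -(hcompM _ _ (hB l j)); congr hcomp; rewrite addrA subrK.
Qed.

Lemma graded_mxM r c m s t u (A : 'M_(r, c)) (B : 'M_(c, m)) :
  graded_mx s t A -> graded_mx t u B -> graded_mx s u (A *m B).
Proof.
move=> hA hB; rewrite -(hmx_id hA) -(hmxM _ _ hB); exact: hmx_graded.
Qed.

End Homogeneous.

(** * Uniqueness of graded Betti numbers *)

(** Chain maps are built degree by degree, each matrix depending on the previous one and having a
    type that depends on the degree. *)
Lemma dependent_choice_seq (T : nat -> Type) (P : forall i, T i -> Prop)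
    (Q : forall i, T i -> T i.+1 -> Prop) (x0 : T 0%N) :
  P 0%N x0 ->
  (forall i x, P i x -> exists y, P i.+1 y /\ Q i x y) ->
  exists f : forall i, T i, f 0%N = x0 /\ forall i, P i (f i) /\ Q i (f i) (f i.+1).
Proof.
move=> P0 PQ.
pose next i (x : {x : T i | P i x}) :=
  constructive_indefinite_description _ (PQ i (sval x) (svalP x)).
pose g := fix g i : {x : T i | P i x} := match i with
  | 0 => exist _ x0 P0
  | j.+1 => exist _ (sval (next j (g j))) (proj1 (svalP (next j (g j))))
  end.
exists (fun i => sval (g i)); split=> // i; split; first exact: svalP.
exact: (proj2 (svalP (next i (g i)))).
Qed.

Lemma rows_solve (R : nzRingType) m r c (A : 'M[R]_(m, c)) (B : 'M[R]_(r, c)) :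
  (forall i, exists v : 'rV_r, row i A = v *m B) -> exists X, A = X *m B.
Proof.
case/fin_all_exists => f hf; exists (\matrix_i f i).
by apply/row_matrixP => i; rewrite row_mul rowK hf.
Qed.

Section Comparison.
Variables (n : nat) (k : fieldType) (I : {mpoly k[n]} -> Prop).

Definition homogeneous_ideal :=
  [/\ forall p q, I p -> I q -> I (p + q),
      forall p q, I p -> I (q * p)
    & forall z p, I p -> I (hcomp z p)].

Hypothesis homI : homogeneous_ideal.

Let ideal_add p q : I p -> I q -> I (p + q).
Proof. by case: homI => h _ _; apply: h. Qed.

Let ideal_mul p q : I p -> I (q * p).
Proof. by case: homI => _ h _; apply: h. Qed.

Let ideal_hcomp z p : I p -> I (hcomp z p).
Proof. by case: homI => _ _; apply. Qed.

Let ideal_sum (J : Type) (r : seq J) (F : J -> {mpoly k[n]}) :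
  I 0 -> (forall i, I (F i)) -> I (\sum_(i <- r) F i).
Proof. by move=> I0 hF; elim/big_rec: _ => // i x _; apply: ideal_add. Qed.

Section Lift.
Variables F G : graded_resolution I.

(** [A] carries boundaries to boundaries, which is what makes the next square of a chain map
    solvable. *)
Let cyc i (A : 'M_(res_rank F i, res_rank G i)) :=
  forall w : 'rV_(res_rank F i.+1),
  exists v : 'rV_(res_rank G i.+1), w *m res_diff F i *m A = v *m res_diff G i.

Lemma aug_lift : exists A : 'M_(res_rank F 0, res_rank G 0),
  graded_mx (@res_shift _ _ _ F 0) (@res_shift _ _ _ G 0) A /\
  forall l, I ((A *m res_aug G - res_aug F) l 0).
Proof.
have [u hu] := res_aug_surj G.
(* Each basis vector goes to its augmentation times [u], a lift of 1; the graded part of this map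
   still lifts the identity because [I] is homogeneous. *)
pose A := \matrix_(l < res_rank F 0, j < res_rank G 0) (res_aug F l 0 * u 0 j).
exists (hmx (@res_shift _ _ _ F 0) (@res_shift _ _ _ G 0) A).
split; first exact: hmx_graded.
move=> l.
have hG : graded_mx (@res_shift _ _ _ G 0) (fun _ : 'I_1 => 0) (res_aug G).
  by move=> i j; rewrite ord1 subr0; apply: res_aug_homog.
have hF : graded_mx (@res_shift _ _ _ F 0) (fun _ : 'I_1 => 0) (res_aug F).
  by move=> i j; rewrite ord1 subr0; apply: res_aug_homog.
rewrite -(hmxM _ _ hG) -(hmx_id hF) !mxE -hcompN.
rewrite -hcompD; apply: ideal_hcomp.
under eq_bigr do rewrite mxE -mulrA.
rewrite -mulr_sumr -{2}[res_aug F l 0]mulr1 -mulrBr; apply: ideal_mul.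
have -> : \sum_i u 0 i * res_aug G i 0 - 1 = -1 * (1 - (u *m res_aug G) 0 0).
  by rewrite mxE mulN1r opprB.
exact: ideal_mul.
Qed.

Lemma ideal0 : I 0.
Proof.
have : I (((0 : 'rV_(res_rank F 0)) *m res_aug F) 0 0).
  by apply/res_exact0; exists 0; rewrite mul0mx.
by rewrite mul0mx mxE.
Qed.

Lemma cyc0 (A : 'M_(res_rank F 0, res_rank G 0)) :
  (forall l, I ((A *m res_aug G - res_aug F) l 0)) -> cyc A.
Proof.
move=> hA w; apply/res_exact0.
have hw : I ((w *m res_diff F 0 *m res_aug F) 0 0) by apply/res_exact0; exists w.
rewrite -[X in I X](subrK ((w *m res_diff F 0 *m res_aug F) 0 0)).
apply: ideal_add => //.
have -> : (w *m res_diff F 0 *m A *m res_aug G) 0 0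
   - (w *m res_diff F 0 *m res_aug F) 0 0
   = (w *m res_diff F 0 *m (A *m res_aug G - res_aug F)) 0 0.
  by rewrite mulmxBr mulmxA !mxE.
by rewrite mxE; apply: ideal_sum => [|i]; [exact: ideal0 | exact: ideal_mul].
Qed.

Lemma cycS i (A : 'M_(res_rank F i, res_rank G i)) B :
  B *m res_diff G i = res_diff F i *m A -> cyc B.
Proof.
move=> hB w; apply/res_exactS; rewrite -mulmxA hB mulmxA.
suff -> : w *m res_diff F i.+1 *m res_diff F i = 0 by rewrite mul0mx.
by apply/res_exactS; exists w.
Qed.

Definition chain_map (phi : forall i, 'M_(res_rank F i, res_rank G i)) :=
  (forall l, I ((phi 0%N *m res_aug G - res_aug F) l 0)) /\
  forall i, phi i.+1 *m res_diff G i = res_diff F i *m phi i.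

(** Each square is solved row by row by exactness of [G]; taking the graded part of the solution
    keeps the square commutative by [hmxM]. *)
Lemma exists_graded_chain_map : exists phi, chain_map phi /\
  forall i, graded_mx (@res_shift _ _ _ F i) (@res_shift _ _ _ G i) (phi i).
Proof.
have [A [gA hA]] := aug_lift.
pose P i (A : 'M_(res_rank F i, res_rank G i)) :=
  graded_mx (@res_shift _ _ _ F i) (@res_shift _ _ _ G i) A /\ cyc A.
pose Q i (A : 'M_(res_rank F i, res_rank G i)) B :=
  B *m res_diff G i = res_diff F i *m A.
have [||f [f0 hf]] := @dependent_choice_seq _ P Q A.
- by split=> //; exact: cyc0.
- move=> i X [gX cX].
  have [|Y hY] := @rows_solve _ _ _ _ (res_diff F i *m X) (res_diff G i).
    move=> l; have [v hv] := cX (delta_mx 0 l).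
    by exists v; rewrite -hv -mulmxA -rowE.
  pose B := hmx (@res_shift _ _ _ F i.+1) (@res_shift _ _ _ G i.+1) Y.
  have hB : Q i X B.
    rewrite /Q /B -(hmxM _ _ (@res_diff_homog _ _ _ G i)) -hY hmx_id //.
    exact: graded_mxM (@res_diff_homog _ _ _ F i) gX.
  exists B; split=> //; split; first exact: hmx_graded.
  exact: cycS hB.
exists f; split; last by move=> i; case: (hf i) => -[].
by split; [rewrite f0 | move=> i; case: (hf i)].
Qed.

End Lift.

Definition const_mx0 r c (A : 'M[{mpoly k[n]}]_(r, c)) : 'M[k]_(r, c) :=
  map_mx (mcoeff 0%MM) A.

Lemma chain_map_comp (F G H : graded_resolution I) phi psi :
  @chain_map F G phi -> @chain_map G H psi ->
  @chain_map F H (fun i => phi i *m psi i).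
Proof.
move=> [p0 pS] [q0 qS]; split=> [l|i]; last first.
  by rewrite -mulmxA qS mulmxA pS mulmxA.
have -> : (phi 0%N *m psi 0%N *m res_aug H - res_aug F) l 0 =
    (phi 0%N *m (psi 0%N *m res_aug H - res_aug G)) l 0
    + (phi 0%N *m res_aug G - res_aug F) l 0.
  by rewrite mulmxBr mulmxA !mxE addrA subrK.
apply: ideal_add => //; rewrite mxE.
by apply: ideal_sum => [|i]; [exact: (ideal0 F) | exact: ideal_mul].
Qed.

(** The difference [theta - 1] is null homotopic, so it is a sum of products with a differential as
    factor, and minimality kills the constant terms of these. *)
Lemma chain_endo_const (F : graded_resolution I) theta :
  minimal_resolution F -> @chain_map F F theta ->
  forall i, const_mx0 (theta i) = 1%:M.
Proof.
move=> minF [h0 hS].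
have cd i : const_mx0 (res_diff F i) = 0.
  by apply/matrixP => u v; rewrite !mxE; apply: minF.
have constM r c m (A : 'M_(r, c)) (B : 'M_(c, m)) :
    const_mx0 (A *m B) = const_mx0 A *m const_mx0 B by exact: map_mxM.
pose eta i := theta i - 1%:M.
have hE i : eta i.+1 *m res_diff F i = res_diff F i *m eta i.
  by rewrite /eta mulmxBl mulmxBr hS mul1mx mulmx1.
have dd i : res_diff F i.+1 *m res_diff F i = 0.
  apply/row_matrixP => l; rewrite row_mul row0; apply/res_exactS.
  by exists (delta_mx 0 l); rewrite -rowE.
(* Of a null homotopy [eta_i = h_i d_i + d_(i-1) h_(i-1)] the induction only
   needs to remember that [d_i (eta_i - h_i d_i) = 0]. *)
suff hQ i : const_mx0 (eta i) = 0 /\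
    exists h : 'M_(res_rank F i, res_rank F i.+1),
      res_diff F i *m (eta i - h *m res_diff F i) = 0.
  move=> i; have [/matrixP he _] := hQ i; apply/matrixP => u v.
  by have /eqP := he u v; rewrite !mxE mcoeffB subr_eq0 => /eqP ->;
    case: eqP; rewrite ?mcoeff1 ?mcoeff0 ?eqxx.
elim: i => [|i [_ [h hh]]].
  have [|h hh] := @rows_solve _ _ _ _ (eta 0%N) (res_diff F 0).
    move=> l; apply/res_exact0; rewrite -row_mul mxE /eta.
    by rewrite mulmxBl mul1mx.
  split; first by rewrite hh constM cd mulmx0.
  by exists h; rewrite hh subrr mulmx0.
have [|h' hh'] := @rows_solve _ _ _ _ (eta i.+1 - res_diff F i *m h) (res_diff F i.+1).
  move=> l; apply/res_exactS; rewrite -row_mul mulmxBl hE -mulmxA -mulmxBr hh.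
  by rewrite row0.
have {}hh' : eta i.+1 = h' *m res_diff F i.+1 + res_diff F i *m h.
  by rewrite -hh' subrK.
split.
  by rewrite hh' /const_mx0 map_mxD -!/(const_mx0 _) !constM !cd mulmx0 mul0mx addr0.
by exists h'; rewrite {1}hh' addrC addrA addNr add0r mulmxA dd mul0mx.
Qed.

(** Modulo the variables the comparison maps satisfy [P *m Q = 1]. Entries of [P] between different
    shifts have nonzero degree, hence no constant term, so the blocks of shift [j] already multiply
    to the identity; its rank [#|A|] is at most the inner dimension [#|B|]. *)
Lemma card_shift_le (F G : graded_resolution I) i j :
  minimal_resolution F ->
  (#|[set l : 'I_(res_rank F i) | res_shift l == j]|
   <= #|[set l : 'I_(res_rank G i) | res_shift l == j]|)%N.
Proof.
move=> minF.
have [phi [cphi gphi]] := exists_graded_chain_map F G.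
have [psi [cpsi _]] := exists_graded_chain_map G F.
have := chain_endo_const minF (chain_map_comp cphi cpsi) i.
rewrite /const_mx0 map_mxM; set P := map_mx _ _; set Q := map_mx _ _ => PQ.
set A := [set _ | _]; set B := [set _ | _].
pose PA := \matrix_(a < #|A|, b < #|B|) P (enum_val a) (enum_val b).
pose QB := \matrix_(b < #|B|, a < #|A|) Q (enum_val b) (enum_val a).
suff h : PA *m QB = 1%:M.
  rewrite -(mxrank1 k #|A|) -h.
  exact: leq_trans (mxrankM_maxl _ _) (rank_leq_col _).
apply/matrixP => a a'; rewrite !mxE.
transitivity (\sum_(v in B) P (enum_val a) v * Q v (enum_val a')).
  by rewrite [RHS]big_enum_val; apply: eq_bigr => b _; rewrite !mxE.
have := congr1 (fun M : 'M_(_) => M (enum_val a) (enum_val a')) PQ.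
rewrite /= !mxE (inj_eq enum_val_inj) => <-.
rewrite [RHS](bigID (mem B)) /= [X in _ + X]big1 ?addr0 // => v.
rewrite inE => nv; suff -> : P (enum_val a) v = 0 by rewrite mul0r.
rewrite mxE; apply: homog_int_const (gphi i _ v) _.
have := enum_valP a; rewrite inE => /eqP ->.
by rewrite subr_eq0 eq_sym.
Qed.

Lemma betti_unique (b b' : nat -> int -> nat) :
  is_betti I b -> is_betti I b' -> forall i j, b i j = b' i j.
Proof.
move=> [F [minF hF]] [G [minG hG]] i j; rewrite hF hG.
by apply/eqP; rewrite eqn_leq !card_shift_le.
Qed.

Lemma bettiE b : is_betti I b -> forall i j, betti I i j = b i j.
Proof.
move=> hb; apply: (betti_unique _ hb).
exact: (epsilon_spec _ (is_betti I) (ex_intro _ b hb)).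
Qed.

End Comparison.

(** * The Koszul resolution *)

(** These evaluate one operation at a time, where [mxE] would also expand matrix products into
    sums. *)
Lemma addmxE (R : nmodType) r c (A B : 'M[R]_(r, c)) i j :
  (A + B) i j = A i j + B i j.
Proof. exact: mxE. Qed.

Lemma oppmxE (R : zmodType) r c (A : 'M[R]_(r, c)) i j : (- A) i j = - A i j.
Proof. exact: mxE. Qed.

Lemma scalemxE (R : nzRingType) r c x (A : 'M[R]_(r, c)) i j :
  (x *: A) i j = x * A i j.
Proof. exact: mxE. Qed.

(** * Mapping cone of multiplication by a nonzerodivisor *)

Section Cone.
Variables (n : nat) (k : fieldType) (I J : {mpoly k[n]} -> Prop).
Variables (d : nat) (f : {mpoly k[n]}).
Hypothesis addI : forall p q, I p -> I q -> I (p + q).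
Hypothesis mulI : forall p q, I p -> I (q * p).
Hypothesis homf : f \is d.-homog.
Hypothesis d_gt0 : (0 < d)%N.
Hypothesis regf : forall g, I (g * f) -> I g.
Hypothesis J_def : forall g, J g <-> exists c, I (g - c * f).
Variable F : graded_resolution I.

(** The rank of the module one step lower, with zero module below degree 0, so that the cone has one
    uniform formula in every degree. *)
Definition prev_rank i := if i is i'.+1 then res_rank F i' else 0%N.

Definition prev_shift i : 'I_(prev_rank i) -> int :=
  if i is i'.+1 then @res_shift _ _ _ F i' else fun _ => 0.

Definition prev_diff i : 'M[{mpoly k[n]}]_(res_rank F i, prev_rank i) :=
  if i is i'.+1 then res_diff F i' else 0.

Definition cone_rank i := (res_rank F i + prev_rank i)%N.

Definition cone_shift i (l : 'I_(cone_rank i)) : int :=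
  match split l with
  | inl u => res_shift u
  | inr v => prev_shift v + d%:Z
  end.

(** Rows act on the right: a pair [(u, w)] goes to [(u d + f w, - w d)], the sign making the square
    of the differential vanish. *)
Definition cone_diff i : 'M[{mpoly k[n]}]_(cone_rank i.+1, cone_rank i) :=
  block_mx (res_diff F i) 0 f%:M (- prev_diff i).

Definition cone_aug : 'cV[{mpoly k[n]}]_(cone_rank 0) :=
  col_mx (res_aug F) 0.

Lemma prev_diff_homog i (u : 'I_(res_rank F i)) (v : 'I_(prev_rank i)) :
  homog_int (res_shift u - prev_shift v) (prev_diff i u v).
Proof. by case: i u v => [|i] u v /=; [case: v | apply: res_diff_homog]. Qed.

Lemma cone_diff_homog i (u : 'I_(cone_rank i.+1)) (v : 'I_(cone_rank i)) :
  homog_int (cone_shift u - cone_shift v) (cone_diff i u v).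
Proof.
rewrite /cone_shift /cone_diff !mxE.
case: (split u) => u'; rewrite !mxE; case: (split v) => v'; rewrite ?mxE.
- exact: res_diff_homog.
- exact: homog_int0.
- case: eqP => [->|_]; last exact: homog_int0.
  by rewrite addrAC subrr add0r.
- rewrite opprD addrACA subrr addr0; exact/homog_intN/prev_diff_homog.
Qed.

Lemma cone_aug_homog (u : 'I_(cone_rank 0)) :
  homog_int (cone_shift u) (cone_aug u 0).
Proof.
rewrite /cone_shift /cone_aug mxE; case: (split u) => v; last by case: v.
exact: res_aug_homog.
Qed.

Lemma idealJ_I g : I g -> J g.
Proof. by move=> Ig; apply/J_def; exists 0; rewrite mul0r subr0. Qed.

Lemma cone_row i (u : 'rV[{mpoly k[n]}]_(cone_rank i)) :
  u = row_mx (lsubmx u) (rsubmx u).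
Proof. by rewrite hsubmxK. Qed.

Lemma cone_aug_surj : exists u : 'rV_(cone_rank 0), J (1 - (u *m cone_aug) 0 0).
Proof.
have [u hu] := res_aug_surj F; exists (row_mx u 0).
by rewrite mul_row_col mulmx0 addr0; apply: idealJ_I.
Qed.

Lemma mul_cone_diff i (u : 'rV[{mpoly k[n]}]_(res_rank F i.+1))
    (w : 'rV[{mpoly k[n]}]_(res_rank F i)) :
  row_mx u w *m cone_diff i
  = row_mx (u *m res_diff F i + f *: w) (- (w *m prev_diff i)).
Proof.
by rewrite /cone_diff mul_row_block mulmx0 add0r mul_mx_scalar mulmxN.
Qed.

Lemma image_aug (u : 'rV_(res_rank F 0)) v :
  u = v *m res_diff F 0 -> I ((u *m res_aug F) 0 0).
Proof. by move=> ->; apply/res_exact0; exists v. Qed.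

Lemma cone_exact0 (u : 'rV_(cone_rank 0)) :
  J ((u *m cone_aug) 0 0) <-> exists v, u = v *m cone_diff 0.
Proof.
rewrite (cone_row u); set x := lsubmx u; set y := rsubmx u.
rewrite mul_row_col mulmx0 addr0 J_def; split.
- move=> [c hc]; have [e he] := res_aug_surj F.
  have [v hv] : exists v, x - (c * f) *: e = v *m res_diff F 0.
    apply/res_exact0; rewrite mulmxBl -scalemxAl addmxE oppmxE scalemxE.
    have -> : (x *m res_aug F) 0 0 - c * f * (e *m res_aug F) 0 0 =
      ((x *m res_aug F) 0 0 - c * f) + c * f * (1 - (e *m res_aug F) 0 0) by ring.
    by apply: addI => //; apply: mulI.
  (* Since [e] lifts 1, the second component [c *: e] absorbs the multiple [c * f] of the new
     generator. *)
  exists (row_mx v (c *: e)); rewrite mul_cone_diff -hv scalerA [f * c]mulrC subrK.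
  by congr row_mx; apply/rowP => -[].
- move=> [v]; rewrite [v]cone_row mul_cone_diff => /eq_row_mx[-> _].
  exists ((rsubmx v *m res_aug F) 0 0).
  rewrite mulmxDl -scalemxAl addmxE scalemxE [f * _]mulrC addrK.
  exact: image_aug.
Qed.

Lemma diff_diff i (v : 'rV_(res_rank F i.+2)) :
  v *m res_diff F i.+1 *m res_diff F i = 0.
Proof. by apply/res_exactS; exists v. Qed.

(** Regularity of [f] enters at [i = 0]: the first equation puts [f] times the augmentation of [w]
    in [I], so the augmentation of [w] is in [I] and [w] is a boundary. Higher up this is exactness
    of [F]. *)
Lemma prev_diff_exact i (w : 'rV[{mpoly k[n]}]_(res_rank F i)) u :
  u *m res_diff F i + f *: w = 0 -> w *m prev_diff i = 0 ->
  exists x, w = - (x *m res_diff F i).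
Proof.
case: i w u => [|i] w u /= hu hw.
  have [|x hx] := (proj1 (res_exact0 (- w))); last first.
    by exists x; rewrite -hx opprK.
  apply: regf; rewrite mulNmx oppmxE.
  have := image_aug (erefl (u *m res_diff F 0)).
  move/eqP: hu; rewrite addr_eq0 => /eqP ->.
  by rewrite mulNmx -scalemxAl oppmxE scalemxE mulrC mulNr.
have [x hx] := (proj1 (res_exactS w) hw).
by exists (- x); rewrite mulNmx opprK.
Qed.

Lemma cone_exactS i (u : 'rV_(cone_rank i.+1)) :
  u *m cone_diff i = 0 <-> exists v, u = v *m cone_diff i.+1.
Proof.
rewrite (cone_row u); set x := lsubmx u; set y : 'rV_(res_rank F i) := rsubmx u.
rewrite mul_cone_diff; split.
- rewrite -row_mx0 => /eq_row_mx[hx /eqP]; rewrite oppr_eq0 => /eqP hy.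
  have [z hz] := prev_diff_exact hx hy.
  (* With [y = - z d], the correction [x - f *: z] is a cycle of [F], because [x d + f y = 0]. *)
  have [v hv] : exists v, x - f *: z = v *m res_diff F i.+1.
    by apply/res_exactS; rewrite mulmxBl -scalemxAl -hx hz scalerN.
  by exists (row_mx v z); rewrite mul_cone_diff -hv subrK hz.
- move=> [v]; rewrite [v]cone_row mul_cone_diff => /eq_row_mx[-> ->] /=.
  rewrite mulmxDl diff_diff add0r scalerN -scalemxAl subrr.
  rewrite -row_mx0; congr row_mx.
  rewrite mulNmx opprK; case: i {u x y} v => [|i] v /=; first by rewrite mulmx0.
  exact: diff_diff.
Qed.

Definition cone : graded_resolution J :=
  GradedResolution cone_diff_homog cone_aug_homog cone_aug_surj cone_exact0
    cone_exactS.

Lemma cone_minimal : minimal_resolution F -> minimal_resolution cone.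
Proof.
move=> minF i u v; rewrite /= /cone_diff !mxE.
case: (split u) => u'; rewrite !mxE; case: (split v) => v'; rewrite ?mxE.
- exact: minF.
- exact: mcoeff0.
- have f0 : f@_0%MM = 0.
    by apply: (@homog_int_const _ _ (Posz d)) => //; rewrite -lt0n.
  by case: eqP => _; rewrite ?mulr1n ?mulr0n ?mcoeff0.
- rewrite mcoeffN; case: i u u' v v' => [|i] u u' v v' /=; first by case: v'.
  by rewrite minF oppr0.
Qed.

Lemma card_cone_shift i (j : int) :
  #|[set l : 'I_(res_rank cone i) | res_shift l == j]| =
  (#|[set l : 'I_(res_rank F i) | res_shift l == j]| +
   if i is i'.+1 then
     #|[set l : 'I_(res_rank F i') | res_shift l == (j - d%:Z)%R]| else 0)%N.
Proof.
rewrite -sum1_card big_mkcond /= big_split_ord /=; congr (_ + _)%N.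
  rewrite -sum1_card [RHS]big_mkcond; apply: eq_bigr => u _.
  by rewrite !inE /= /cone_shift (unsplitK (inl u)).
case: i => [|i] /=; first by rewrite big_ord0.
rewrite -sum1_card [RHS]big_mkcond; apply: eq_bigr => u _.
by rewrite !inE /= /cone_shift (unsplitK (inr u)) /= [in RHS]eq_sym subr_eq eq_sym.
Qed.

End Cone.

(** * Betti numbers of a regular sequence *)

Section Koszul.
Variables (n : nat) (k : fieldType).
Implicit Types (s : seq {mpoly k[n]}) (ps : seq ({mpoly k[n]} * nat)).

Lemma ideal_gen_rcons s f g :
  ideal_gen (rcons s f) g <-> exists c, ideal_gen s (g - c * f).
Proof.
rewrite /ideal_gen size_rcons; split=> [[c ->]|[c [c' hc']]].
  exists (c (size s)); exists c.
  rewrite big_ord_recr /= nth_rcons ltnn eqxx addrK.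
  by apply: eq_bigr => i _; rewrite nth_rcons ltn_ord.
exists (fun j => if (j < size s)%N then c' j else c).
rewrite big_ord_recr /= nth_rcons ltnn eqxx; apply/eqP; rewrite -subr_eq hc'.
by apply/eqP/eq_bigr => i _; rewrite nth_rcons ltn_ord.
Qed.

Lemma ideal_genD s p q : ideal_gen s p -> ideal_gen s q -> ideal_gen s (p + q).
Proof.
move=> [c ->] [c' ->]; exists (fun j => c j + c' j).
by rewrite -big_split; apply: eq_bigr => i _; rewrite mulrDl.
Qed.

Lemma ideal_genM s p q : ideal_gen s p -> ideal_gen s (q * p).
Proof.
move=> [c ->]; exists (fun j => q * c j).
by rewrite mulr_sumr; apply: eq_bigr => i _; rewrite mulrA.
Qed.

Definition homog_pairs ps := all (fun p => (p.1 \is p.2.-homog) && (0 < p.2)%N) ps.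

Lemma ideal_gen_homogeneous ps :
  homog_pairs ps -> homogeneous_ideal (ideal_gen (unzip1 ps)).
Proof.
move=> hps; split; [exact: ideal_genD | exact: ideal_genM | move=> z p [c ->]].
(* The component of degree [z] of a combination uses, for the generator of degree [a_j], the
   component of its coefficient in degree [z - a_j]. *)
exists (fun j => hcomp (z - Posz (nth 0%N (unzip2 ps) j)) (c j)).
rewrite hcomp_sum; apply: eq_bigr => i _.
have hi : (i < size ps)%N by rewrite -(size_map fst).
rewrite -{1}[z](subrK (Posz (nth 0%N (unzip2 ps) i))) hcompM //.
by rewrite !(nth_map (0, 0%N)) //=; have /andP[] := all_nthP (0, 0%N) hps i hi.
Qed.

(** Counts the [i]-element subsets of positions in [ds] with sum [j], according to whether the head
    is chosen; this is the recursion of the mapping cone. *)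
Fixpoint koszul_betti (ds : seq nat) (i : nat) (j : int) : nat :=
  if ds is d :: ds' then
    (koszul_betti ds' i j +
     if i is i'.+1 then koszul_betti ds' i' (j - d%:Z)%R else 0)%N
  else (i == 0%N) && (j == 0).

(** The zero ideal is resolved by [S] alone, placed in homological degree 0 without shift. *)
Definition trivial_rank i : nat := (i == 0)%N.

Lemma trivial_exact0 (u : 'rV[{mpoly k[n]}]_(trivial_rank 0)) :
  ideal_gen [::] ((u *m (1%:M : 'M_1)) 0 0) <->
  exists v : 'rV_(trivial_rank 1),
    u = v *m (0 : 'M[{mpoly k[n]}]_(trivial_rank 1, trivial_rank 0)).
Proof.
rewrite mulmx1 /ideal_gen; split=> [[c]|[v ->]]; last first.
  by exists (fun _ => 0); rewrite mulmx0 mxE big_ord0.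
rewrite big_ord0 => u0; exists 0; rewrite mulmx0.
by apply/rowP => i; rewrite !ord1 u0 mxE.
Qed.

Lemma trivial_exactS i (u : 'rV[{mpoly k[n]}]_(trivial_rank i.+1)) :
  u *m (0 : 'M[{mpoly k[n]}]_(trivial_rank i.+1, trivial_rank i)) = 0 <->
  exists v : 'rV_(trivial_rank i.+2),
    u = v *m (0 : 'M[{mpoly k[n]}]_(trivial_rank i.+2, trivial_rank i.+1)).
Proof.
split=> _; last by rewrite mulmx0.
by exists 0; rewrite mulmx0; apply/rowP => -[].
Qed.

Lemma trivial_aug_surj : exists u : 'rV[{mpoly k[n]}]_(trivial_rank 0),
  ideal_gen [::] (1 - (u *m (1%:M : 'M_1)) 0 0).
Proof.
exists 1%:M; rewrite mulmx1 mxE /= subrr.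
by exists (fun _ => 0); rewrite big_ord0.
Qed.

Lemma trivial_aug_homog (u : 'I_(trivial_rank 0)) :
  homog_int 0 ((1%:M : 'M[{mpoly k[n]}]_1) u 0).
Proof. by rewrite ord1 mxE; apply: dhomog1. Qed.

Definition trivial_resolution :
    graded_resolution (ideal_gen ([::] : seq {mpoly k[n]})) :=
  @GradedResolution n k _ trivial_rank (fun _ _ => 0) (fun _ => 0) 1%:M
    (fun i u v => ltac:(rewrite mxE; exact: homog_int0))
    trivial_aug_homog trivial_aug_surj trivial_exact0 trivial_exactS.

(** The cone adds the last generator, while [koszul_betti] peels off the head; hence the reversal of
    the degrees. *)
Lemma is_betti_koszul ps : homog_pairs ps ->
  (forall (i : nat) g, (i < size ps)%N ->
     ideal_gen (take i (unzip1 ps)) (g * (unzip1 ps)`_i) ->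
     ideal_gen (take i (unzip1 ps)) g) ->
  is_betti (ideal_gen (unzip1 ps)) (koszul_betti (rev (unzip2 ps))).
Proof.
elim/last_ind: ps => [|ps [f d] IH].
  move=> _ _; exists trivial_resolution; split=> [i u v|i j].
    by rewrite mxE mcoeff0.
  case: i => [|i] /=; last first.
    by apply/esym/eqP; rewrite cards_eq0; apply/eqP/setP => -[].
  case: eqP => [->|ne] /=.
    transitivity #|[set: 'I_1]|; first by rewrite cardsT card_ord.
    by apply: eq_card => l; rewrite !inE.
  apply/esym/eqP; rewrite cards_eq0; apply/eqP/setP => l; rewrite !inE.
  by apply/eqP => j0; apply: ne.
rewrite /homog_pairs /unzip1 /unzip2 !map_rcons all_rcons size_rcons rev_rcons /=.
move=> /andP[/andP[hf d0] hps] hreg.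
have [|F [minF hF]] := IH hps.
  move=> i g hi; have := hreg i g (ltnW hi).
  rewrite -cats1 takel_cat ?size_map; last exact: ltnW.
  by rewrite nth_cat size_map hi.
have regf g : ideal_gen (unzip1 ps) (g * f) -> ideal_gen (unzip1 ps) g.
  have := hreg (size ps) g (leqnn _).
  by rewrite -cats1 take_size_cat ?size_map // nth_cat size_map ltnn subnn.
exists (cone (@ideal_genD _) (@ideal_genM _) hf regf (@ideal_gen_rcons _ _) F).
split=> [|i j]; first exact: cone_minimal.
by rewrite card_cone_shift -!hF; case: i => [|i] /=; rewrite -?hF.
Qed.

Lemma betti_koszul ps : homog_pairs ps -> regular_sequence (unzip1 ps) ->
  forall i j, betti (ideal_gen (unzip1 ps)) i j
              = koszul_betti (rev (unzip2 ps)) i j.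
Proof.
move=> hps [reg _]; apply: bettiE; first exact: ideal_gen_homogeneous.
by apply: is_betti_koszul => // i g hi; apply: reg; rewrite size_map.
Qed.

End Koszul.

(** * Chains of pure diagrams *)

Section PureDiagrams.
Implicit Types (d e : seq int) (b : diagram) (L : decomposition).

Lemma pure_ge0 d i j : 0 <= pure d i j.
Proof.
rewrite /pure; case: ifP => // _; apply: prodr_ge0 => l _.
by rewrite invr_ge0 ler0z normr_ge0.
Qed.

Lemma pure_gt0 d i : degree_sequence d -> (i < size d)%N -> 0 < pure d i d`_i.
Proof.
move=> hd hi; rewrite /pure hi eqxx /=; apply: prodr_gt0 => l ne.
rewrite invr_gt0 ltr0z normr_gt0 subr_eq0.
rewrite nth_uniq // 1?eq_sym //.
exact: (sorted_uniq lt_trans (@ltxx _ _)).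
Qed.

Lemma pure_neq0 d i j : pure d i j != 0 -> (i < size d)%N /\ j = d`_i.
Proof.
by rewrite /pure; case: ifP => [/andP[-> /eqP ->] //|_]; rewrite eqxx.
Qed.

Definition degree_le d e :=
  (size d == size e) && all (fun i => d`_i <= e`_i) (iota 0 (size d)).

Lemma degree_leP d e : reflect
  (size d = size e /\ forall i, (i < size d)%N -> d`_i <= e`_i) (degree_le d e).
Proof.
apply: (iffP andP) => [[/eqP hs /allP h]|[hs h]].
  by split=> // i hi; apply: h; rewrite mem_iota.
by rewrite hs eqxx; split=> //; apply/allP => i; rewrite mem_iota -hs => /h.
Qed.

Lemma degree_le_trans : transitive degree_le.
Proof.
move=> e d f /degree_leP[s1 h1] /degree_leP[s2 h2]; apply/degree_leP.
split=> [|i hi]; first by rewrite s1.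
by apply: le_trans (h1 i hi) _; apply: h2; rewrite -s1.
Qed.

Lemma degree_le_neq d e : degree_le d e -> d != e ->
  exists2 i, (i < size d)%N & d`_i < e`_i.
Proof.
move=> /degree_leP[hs h] ne.
have [/existsP[i hi]|] := boolP [exists i : 'I_(size d), d`_i < e`_i].
  by exists i.
rewrite negb_exists => /forallP hn; case/eqP: ne.
apply: (@eq_from_nth _ 0) => // i hi; apply/eqP; rewrite eq_le h //=.
by have := hn (Ordinal hi); rewrite -leNgt.
Qed.

Lemma boij_soderberg_chain m b L :
  decomposes b L ->
  all (fun t => [&& 0 < t.1, degree_sequence t.2 & size t.2 == m.+1]) L ->
  sorted degree_le (unzip2 L) -> uniq (unzip2 L) -> boij_soderberg b L.
Proof.
elim: L b => [|[q d] L IH] b hb.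
  by move=> _ _ _; apply: BS_stop => i j; rewrite hb big_nil.
move=> /= /andP[/and3P[q0 hd /eqP sd] hL] hp /andP[dL uL].
have hle := order_path_min degree_le_trans hp.
have bE i j : b i j = q * pure d i j + \sum_(t <- L) t.1 * pure t.2 i j.
  by rewrite hb big_cons.
have L_ge0 i j : 0 <= \sum_(t <- L) t.1 * pure t.2 i j.
  rewrite big_seq; apply: sumr_ge0 => t tL; apply: mulr_ge0; last exact: pure_ge0.
  by have /and3P[/ltW] := allP hL t tL.
have L_neq0 i j : \sum_(t <- L) t.1 * pure t.2 i j != 0 ->
    exists2 t, t \in L & (i < size t.2)%N /\ j = t.2`_i.
  move=> nz; suff /hasP[t tL] : has (fun t => pure t.2 i j != 0) L.
    by move=> /pure_neq0; exists t.
  apply: contraR nz => /hasPn h; rewrite big_seq big1 // => t /h.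
  by rewrite negbK => /eqP ->; rewrite mulr0.
have tailb : decomposes (sub_pure b q d) L.
  by move=> i j; rewrite /sub_pure bE addrAC subrr add0r.
apply: (@BS_step b q d L) => //; last exact: IH (path_sorted hp) uL.
(* Positive coefficients exclude cancellation, so the support of [b] is the union of the supports of
   the terms, and the first sequence of the chain is its termwise minimum. *)
- split=> // [i hi|i j hi].
    split=> [|j].
      apply/eqP; rewrite gt_eqF // bE ltr_wpDr //.
      by rewrite mulr_gt0 ?pure_gt0.
    rewrite bE => /eqP; have [p0|/pure_neq0[_ -> //]] := eqVneq (pure d i j) 0.
    rewrite p0 mulr0 add0r => /L_neq0[t tL [_ ->]].
    have /degree_leP[_] := allP hle t.2 (map_f snd tL); exact.
  rewrite bE; have [p0|/pure_neq0[]] := eqVneq (pure d i j) 0; last first.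
    by rewrite ltnNge hi.
  rewrite p0 mulr0 add0r; apply/eqP; apply: contraTT hi => /L_neq0[t tL [it _]].
  have /degree_leP[sz _] := allP hle t.2 (map_f snd tL); by rewrite -ltnNge sz.
- split=> [i j|q' hq']; first by rewrite tailb.
  suff [i hi hz] : exists2 i, (i < size d)%N &
      \sum_(t <- L) t.1 * pure t.2 i d`_i = 0.
    have := hq' i d`_i; rewrite /sub_pure bE hz addr0 -mulrBl.
    by rewrite pmulr_lge0 ?pure_gt0 // subr_ge0.
  case: L {IH hb bE L_ge0 tailb} hL hp dL uL hle L_neq0 => [|t L] /=.
    (* For the last term the tail is empty and any index bounds the coefficient. *)
    by move=> *; exists 0%N; rewrite ?sd // big_nil.
  move=> _ /andP[dt htL]; rewrite inE negb_or => /andP[ne _] _ _ L_neq0.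
  have [i hi lti] := degree_le_neq dt ne.
  exists i => //; apply/eqP; apply: contraT => /L_neq0[u].
  rewrite inE => /orP[/eqP ->|uL] [_ e]; first by rewrite e ltxx in lti.
  have /degree_leP[_] := allP (order_path_min degree_le_trans htL) _ (map_f snd uL).
  have /degree_leP[sz _] := dt.
  by rewrite -sz => /(_ i hi); rewrite -e leNgt lti.
Qed.

(** * Merging terms with equal degree sequences *)

Definition grouped_coef L d : rat := \sum_(u <- L | u.2 == d) u.1.

Lemma unzip2_collect L :
  unzip2 (collect L) = [seq d <- undup (unzip2 L) | grouped_coef L d != 0].
Proof. by rewrite /unzip2 /collect filter_map -map_comp map_id. Qed.

Lemma decomposes_collect b L : decomposes b L -> decomposes b (collect L).
Proof.
move=> hb i j; rewrite hb /collect big_filter [RHS]big_mkcond big_map /=.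
transitivity (\sum_(d <- undup (unzip2 L)) \sum_(u <- L | u.2 == d)
    u.1 * pure u.2 i j); last first.
  apply: eq_bigr => d _ /=.
  transitivity ((\sum_(u <- L | u.2 == d) u.1) * pure d i j).
    by rewrite mulr_suml; apply: eq_bigr => u /eqP ->.
  by case: eqP => // ->; rewrite mul0r.
rewrite (exchange_big_dep predT) //= big_seq [RHS]big_seq.
apply: eq_bigr => u uL.
have hu : u.2 \in undup (unzip2 L) by rewrite mem_undup map_f.
rewrite (eq_bigl (fun d => d == u.2)); last by move=> d; rewrite eq_sym.
by rewrite -big_filter filter_pred1_uniq ?undup_uniq // big_seq1.
Qed.

(** The order is not strict, so repeated sequences are allowed in [L]. The sequences kept by
    [collect] form a subsequence without repetition, and their coefficients, nonnegative and
    nonzero, are positive. *)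
Lemma boij_soderberg_collect m b L :
  decomposes b L ->
  all (fun d => degree_sequence d && (size d == m.+1)) (unzip2 L) ->
  sorted degree_le (unzip2 L) -> (forall d, 0 <= grouped_coef L d) ->
  boij_soderberg b (collect L).
Proof.
move=> hb hL hs h0; apply: (@boij_soderberg_chain m).
- exact: decomposes_collect.
- apply/allP => t; rewrite mem_filter => /andP[nz /mapP[d]].
  rewrite mem_undup => dL e; rewrite {t}e /= in nz *.
  by rewrite lt_def nz h0 /=; apply: (allP hL).
- rewrite unzip2_collect; apply: subseq_sorted hs; first exact: degree_le_trans.
  exact: subseq_trans (filter_subseq _ _) (undup_subseq _).
- by rewrite unzip2_collect filter_uniq ?undup_uniq.
Qed.

(** Strict increase fixes every sign, so the absolute values disappear and each row is a rational
    function that [field] can treat. *)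
Lemma pure5E (d0 d1 d2 d3 d4 : int) i j :
  d0 < d1 -> d1 < d2 -> d2 < d3 -> d3 < d4 ->
  let x0 : rat := d0%:~R in let x1 : rat := d1%:~R in let x2 : rat := d2%:~R in
  let x3 : rat := d3%:~R in let x4 : rat := d4%:~R in
  pure [:: d0; d1; d2; d3; d4] i j =
  nth 0 [::
    (j == d0)%:R / ((x1 - x0) * (x2 - x0) * (x3 - x0) * (x4 - x0));
    (j == d1)%:R / ((x1 - x0) * (x2 - x1) * (x3 - x1) * (x4 - x1));
    (j == d2)%:R / ((x2 - x0) * (x2 - x1) * (x3 - x2) * (x4 - x2));
    (j == d3)%:R / ((x3 - x0) * (x3 - x1) * (x3 - x2) * (x4 - x3));
    (j == d4)%:R / ((x4 - x0) * (x4 - x1) * (x4 - x2) * (x4 - x3))] i.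
Proof.
move=> h01 h12 h23 h34 x0 x1 x2 x3 x4.
have h02 := lt_trans h01 h12; have h03 := lt_trans h02 h23.
have h04 := lt_trans h03 h34; have h13 := lt_trans h12 h23.
have h14 := lt_trans h13 h34; have h24 := lt_trans h23 h34.
have D (x y : int) : x < y ->
    (`|x - y|%:~R : rat) = y%:~R - x%:~R /\ (`|y - x|%:~R : rat) = y%:~R - x%:~R.
  by move=> h; rewrite distrC gtr0_norm ?subr_gt0 // rmorphB.
have [e01 f01] := D _ _ h01; have [e02 f02] := D _ _ h02.
have [e03 f03] := D _ _ h03; have [e04 f04] := D _ _ h04.
have [e12 f12] := D _ _ h12; have [e13 f13] := D _ _ h13.
have [e14 f14] := D _ _ h14; have [e23 f23] := D _ _ h23.
have [e24 f24] := D _ _ h24; have [e34 f34] := D _ _ h34.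
rewrite /pure.
case: i => [|[|[|[|[|i]]]]] /=; last by rewrite nth_nil.
all: case: eqP => _; rewrite ?mul0r // big_mkcond !big_ord_recl big_ord0 /=.
all: rewrite ?(e01, e02, e03, e04, e12, e13, e14, e23, e24, e34).
all: rewrite ?(f01, f02, f03, f04, f12, f13, f14, f23, f24, f34).
all: by rewrite -/x0 -/x1 -/x2 -/x3 -/x4 !invfM !mul1r ?mulr1 !mulrA.
Qed.

End PureDiagrams.

(** * The explicit decompositions *)

Lemma koszul_betti4E (a1 a2 a3 a4 : nat) (i : nat) (j : int) :
  let X (d : int) : rat := (j == d)%:R in
  (koszul_betti [:: a4; a3; a2; a1] i j)%:R =
  nth 0 [:: X 0; X a1%:Z + X a2%:Z + X a3%:Z + X a4%:Z;
    X (a1%:Z + a2%:Z) + X (a1%:Z + a3%:Z) + X (a2%:Z + a3%:Z)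
      + X (a1%:Z + a4%:Z) + X (a2%:Z + a4%:Z) + X (a3%:Z + a4%:Z);
    X (a1%:Z + a2%:Z + a3%:Z) + X (a1%:Z + a2%:Z + a4%:Z)
      + X (a1%:Z + a3%:Z + a4%:Z) + X (a2%:Z + a3%:Z + a4%:Z);
    X (a1%:Z + a2%:Z + a3%:Z + a4%:Z)] i.
Proof.
move=> X; rewrite {}/X.
case: i => [|[|[|[|[|i]]]]] /=; rewrite ?andbF ?addn0 ?nth_nil //.
all: rewrite !subr_eq ?add0r ?natrD; ring.
Qed.

Lemma betti_diagram_ci (k : fieldType) (a1 a2 a3 a4 : nat)
    (f1 f2 f3 f4 : {mpoly k[4]}) :
  (0 < a1)%N -> (0 < a2)%N -> (0 < a3)%N -> (0 < a4)%N ->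
  complete_intersection a1 a2 a3 a4 f1 f2 f3 f4 ->
  forall i j, betti_diagram (ideal_gen [:: f1; f2; f3; f4]) i j
              = (koszul_betti [:: a4; a3; a2; a1] i j)%:R.
Proof.
move=> p1 p2 p3 p4 [h1 h2 h3 h4 reg] i j; rewrite /betti_diagram.
pose ps := [:: (f1, a1); (f2, a2); (f3, a3); (f4, a4)].
by rewrite (@betti_koszul _ _ ps) // /homog_pairs /= h1 h2 h3 h4 p1 p2 p3 p4.
Qed.

Ltac split_nz := repeat (apply/andP; split); apply/eqP => ?; lra.

Section Decompositions.
Variables (a1 a2 a3 a4 : nat).
Hypotheses (a1_gt0 : (0 < a1)%N) (le12 : (a1 <= a2)%N) (le23 : (a2 <= a3)%N)
  (le34 : (a3 <= a4)%N).

Let r1 : 0 < a1%:R :> rat. Proof. by rewrite ltr0n. Qed.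
Let r12 : a1%:R <= a2%:R :> rat. Proof. by rewrite ler_nat. Qed.
Let r23 : a2%:R <= a3%:R :> rat. Proof. by rewrite ler_nat. Qed.
Let r34 : a3%:R <= a4%:R :> rat. Proof. by rewrite ler_nat. Qed.

(** In each row this is an identity of rational functions in the degrees, the indicators of [j]
    serving as independent unknowns. It holds whatever the signs of the coefficients. *)
Lemma case1_decomposes b :
  (forall i j, b i j = (koszul_betti [:: a4; a3; a2; a1] i j)%:R) ->
  decomposes b (case1_terms a1 a2 a3 a4).
Proof.
move=> bE i j; rewrite bE koszul_betti4E /case1_terms /case1_degrees.
rewrite /case1_coefs /case1_y4 /rev /= !big_cons big_nil !pure5E; try lia.
rewrite !intrD -!pmulrn.
move: r1 r12 r23 r34; move: (a1%:R : rat) (a2%:R : rat) (a3%:R : rat) (a4%:R : rat).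
move=> x1 x2 x3 x4 p1 p12 p23 p34.
case: i => [|[|[|[|[|i]]]]] /=; last by rewrite !nth_nil !mulr0 !addr0.
- field; split_nz.
- field; split_nz.
- field; split_nz.
- field; split_nz.
- field; split_nz.
Qed.

Lemma case2_decomposes b :
  a1 = a2 -> (forall i j, b i j = (koszul_betti [:: a4; a3; a2; a1] i j)%:R) ->
  decomposes b (case2_terms a1 a3 a4).
Proof.
move=> e12 bE i j; rewrite bE -e12 koszul_betti4E /case2_terms /case2_degrees.
rewrite /case2_coefs /rev /= !big_cons big_nil !pure5E; try lia.
(* Makes the indicators on the two sides syntactically equal, so that [field] sees the same
   unknowns. *)
have -> : 2 * a1%:Z = a1%:Z + a1%:Z by lia.
rewrite !intrD -!pmulrn.
move: r1 r12 r23 r34; rewrite -e12 {e12}.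
move: (a1%:R : rat) (a3%:R : rat) (a4%:R : rat).
move=> x1 x3 x4 p1 _ p23 p34.
case: i => [|[|[|[|[|i]]]]] /=; last by rewrite !nth_nil !mulr0 !addr0.
- field; split_nz.
- field; split_nz.
- field; split_nz.
- field; split_nz.
- field; split_nz.
Qed.

End Decompositions.

(** * Nonnegativity of the coefficients *)

Lemma grouped_coef_ge0 (L : decomposition) d :
  all (fun c => 0 <= c) (unzip1 L) -> 0 <= grouped_coef L d.
Proof.
move=> /allP h; rewrite /grouped_coef big_seq_cond; apply: sumr_ge0 => u.
by case/andP=> uL _; apply/h/map_f.
Qed.

(* For [a2 = a3] the degree sequences e^2, e^3, e^4 coincide (and so do e^9,
   e^10, e^11); y_2 and y_4 may then be negative, but not y_2 + y_3 + y_4. *)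
Lemma merged_terms_ge0 (y1 y2 y3 y4 y5 y6 n0 n1 n2 n3 n4 n5 n6 n7 : rat) :
  0 <= n0 -> 0 <= n1 -> 0 <= n2 -> 0 <= n3 -> 0 <= n4 -> 0 <= n5 -> 0 <= n6 ->
  0 <= n7 -> 0 <= y1 -> 0 <= y2 + y3 + y4 -> 0 <= y5 -> 0 <= y6 ->
  0 <= y1 * n0 + (y2 * n1 + (y3 * n1 + (y4 * n1 + (y5 * n2 + (y6 * n3 +
    (y6 * n4 + (y5 * n5 + (y4 * n6 + (y3 * n6 + (y2 * n6 + (y1 * n7
    + 0))))))))))).
Proof.
move=> p0 p1 p2 p3 p4 p5 p6 p7 h1 h234 h5 h6.
have := mulr_ge0 h1 p0; have := mulr_ge0 h1 p7; have := mulr_ge0 h234 p1.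
have := mulr_ge0 h234 p6; have := mulr_ge0 h5 p2; have := mulr_ge0 h5 p5.
have := mulr_ge0 h6 p3; have := mulr_ge0 h6 p4.
lra.
Qed.

Section Outputs.
Variables (a1 a2 a3 a4 : nat) (b : diagram).
Hypotheses (a1_gt0 : (0 < a1)%N) (le12 : (a1 <= a2)%N) (le23 : (a2 <= a3)%N).
Hypothesis bE : forall i j, b i j = (koszul_betti [:: a4; a3; a2; a1] i j)%:R.

Let r1 : 0 < a1%:R :> rat. Proof. by rewrite ltr0n. Qed.
Let r12 : a1%:R <= a2%:R :> rat. Proof. by rewrite ler_nat. Qed.
Let r23 : a2%:R <= a3%:R :> rat. Proof. by rewrite ler_nat. Qed.

Ltac split_lia := rewrite /= /degree_sequence /degree_le /= ?andbT;
  repeat (apply/andP; split); lia.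

Lemma unzip2_case1 : unzip2 (case1_terms a1 a2 a3 a4) = case1_degrees a1 a2 a3 a4.
Proof. by rewrite /case1_terms /unzip2 -/unzip2 unzip2_zip. Qed.

Lemma case1_boij_soderberg : (a1 + a2 + a3 < a4)%N ->
  (forall d, 0 <= grouped_coef (case1_terms a1 a2 a3 a4) d) ->
  boij_soderberg b (collect (case1_terms a1 a2 a3 a4)).
Proof.
move=> lt4 h0; apply: (@boij_soderberg_collect 4) => //.
- by apply: case1_decomposes => //; lia.
- rewrite unzip2_case1; split_lia.
- rewrite unzip2_case1; split_lia.
Qed.

(** Includes [a1 = a2 = a3], where still more sequences coincide; a merged coefficient is then a sum
    of several of the nonnegative groups. *)
Lemma case1_grouped_eq : a2 = a3 -> (a1 + a2 + a3 < a4)%N ->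
  forall d, 0 <= grouped_coef (case1_terms a1 a2 a3 a4) d.
Proof.
move=> e23 lt4 d.
have r4 : a1%:R + a2%:R + a3%:R <= a4%:R :> rat by rewrite -!natrD ler_nat ltnW.
(* Writing each condition as a 0-1 factor brings the merged coefficient to the form of
   [merged_terms_ge0]. *)
have mkX (c : rat) (P : bool) : (if P then c else 0) = c * P%:R.
  by case: P; rewrite ?mulr1 ?mulr0.
rewrite /grouped_coef big_mkcond /case1_terms /case1_degrees /case1_coefs.
rewrite /case1_y4 /rev /= !big_cons big_nil /= !mkX -e23.
move: r1 r12 r4; rewrite -e23.
move=> p1 p12 p4.
have p2 := lt_le_trans p1 p12.
have s1 := mulr_gt0 p1 p2.
apply: merged_terms_ge0; rewrite ?ler0n //.
- by rewrite !mulr_ge0 //; lra.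
- set y := (X in 0 <= X).
  have -> : y = a1%:R * a2%:R * (2 * a2%:R * (a2%:R - a1%:R + a4%:R)).
    by rewrite /y; ring.
  by rewrite !mulr_ge0 //; lra.
- set y := (X in 0 <= X).
  (* This is y_5 at [a2 = a3]; its last factor is positive because [a4] is at least [a1 + 2 * a2],
     hence at least [3 * a1]. *)
  have -> : y = a1%:R * a2%:R * (2 * a2%:R * (a4%:R - 2 * a1%:R)).
    by rewrite /y; ring.
  by rewrite !mulr_ge0 //; lra.
- by rewrite !mulr_ge0 //; lra.
Qed.

Lemma case1_grouped_lt : (a1 < a2)%N -> (a2 < a3)%N ->
  a1%:R + a2%:R + a3%:R < a4%:R :> rat ->
  rho2 a1%:R a2%:R a3%:R < a4%:R ->
  0 <= case1_y4 a1%:R a2%:R a3%:R a4%:R ->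
  forall d, 0 <= grouped_coef (case1_terms a1 a2 a3 a4) d.
Proof.
move=> lt12 lt23 lt4 h2 h4 d; apply: grouped_coef_ge0.
rewrite /case1_terms [unzip1 _]unzip1_zip // /case1_coefs.
have p12 : a1%:R < a2%:R :> rat by rewrite ltr_nat.
have p23 : a2%:R < a3%:R :> rat by rewrite ltr_nat.
move: r1 lt4 h2 h4 p12 p23.
move: (a1%:R : rat) (a2%:R : rat) (a3%:R : rat) (a4%:R : rat).
move=> x1 x2 x3 x4 p1 p4 h2 h4 p12 p23.
have p2 := lt_trans p1 p12; have p3 := lt_trans p2 p23.
have s1 := mulr_gt0 p1 p2.
set y4 := case1_y4 _ _ _ _ in h4 *.
have y1 : 0 <= x1 * x2 * (x2 + x3) * (x2 + x3 + x4) by rewrite !mulr_ge0 //; lra.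
have y3 : 0 <= x1 * x2 * (x1 - x2 + x3) * (x1 + x2 + 4 * x3 + 2 * x4).
  by rewrite !mulr_ge0 //; lra.
have y6 : 0 <= 6 * x1 * x2 * x3 * (x1 - x3 + x4) by rewrite !mulr_ge0 //; lra.
have y2 : 0 <= - (x1 * x2 * (x1 * x2 + 2 * x1 * x3 - x3 ^+ 2 + x1 * x4 - x3 * x4)).
  rewrite -mulrN mulr_ge0 ?ltW //.
  (* Clearing the positive denominator [x3 - x1], the bound by [rho2] says exactly that y_2 is
     positive. *)
  by move: h2; rewrite /rho2 ltr_pdivrMr; lra.
(* 4 x1 x3 <= (x2 + x3)^2 makes the bound x1 + x2 + x3 < x4 sufficient. *)
have y5 : 0 <= x1 * x2 * (x1 * x2 - 5 * x1 * x3 + x2 * x4 + x3 * x4).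
  rewrite mulr_ge0 ?(ltW s1) //.
  have q1 : 0 <= (x2 + x3) * (x4 - (x1 + x2 + x3)) by rewrite mulr_ge0 //; lra.
  have q2 : 0 <= (x2 - x1) * x3 by rewrite mulr_ge0 //; lra.
  have q3 := sqr_ge0 (x2 - x3).
  lra.
by rewrite /= y1 y2 y3 h4 y5 y6.
Qed.

Lemma unzip2_case2 : unzip2 (case2_terms a1 a3 a4) = case2_degrees a1 a3 a4.
Proof. by rewrite /case2_terms /unzip2 -/unzip2 unzip2_zip. Qed.

Lemma case2_boij_soderberg : a1 = a2 -> (2 * a1 + a3 <= a4)%N ->
  (4 * a1 <= a4)%N ->
  boij_soderberg b (collect (case2_terms a1 a3 a4)).
Proof.
move=> e12 h1 h2; apply: (@boij_soderberg_collect 4) => //.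
- by apply: (@case2_decomposes a1 a2 a3 a4) => //; lia.
- rewrite unzip2_case2; split_lia.
- rewrite unzip2_case2; split_lia.
- move=> d; apply: grouped_coef_ge0.
  rewrite /case2_terms [unzip1 _]unzip1_zip // /case2_coefs.
  have q1 : 2 * a1%:R + a3%:R <= a4%:R :> rat by rewrite -natrM -natrD ler_nat.
  have q2 : 4 * a1%:R <= a4%:R :> rat by rewrite -natrM ler_nat.
  move: r1 r23 q1 q2; rewrite -e12 {e12}.
  move: (a1%:R : rat) (a3%:R : rat) (a4%:R : rat) => x1 x3 x4 p1 p13 p4 p4'.
  have p0 : 0 <= x1 by lra.
  have y1 : 0 <= 2 * x1 ^+ 2 * x3 * (x3 + x4) by rewrite !mulr_ge0 ?sqr_ge0 //; lra.
  have y2 : 0 <= 2 * x1 ^+ 2 * x3 * (x1 + 2 * x3 + x4).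
    by rewrite !mulr_ge0 ?sqr_ge0 //; lra.
  have y3 : 0 <= - (2 * x1 ^+ 2 * x3 * (4 * x1 - x4)).
    by rewrite -mulrN !mulr_ge0 ?sqr_ge0 //; lra.
  have y4 : 0 <= 6 * x1 ^+ 2 * x3 * (x1 - x3 + x4).
    by rewrite !mulr_ge0 ?sqr_ge0 //; lra.
  by rewrite /= y1 y2 y3 y4.
Qed.

End Outputs.

Lemma case1_above_threshold (a1 a2 a3 a4 : nat) (b : diagram) :
  (0 < a1)%N -> in_case1 a1 a2 a3 ->
  (forall i j, b i j = (koszul_betti [:: a4; a3; a2; a1] i j)%:R) ->
  case1_threshold a1%:R a2%:R a3%:R < a4%:R ->
  decomposes b (case1_terms a1 a2 a3 a4) /\
  (a2 = a3 \/ 0 <= case1_y4 a1%:R a2%:R a3%:R a4%:R ->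
   boij_soderberg b (collect (case1_terms a1 a2 a3 a4))).
Proof.
move=> a1_gt0 hc bE thr.
have le12 : (a1 <= a2)%N by case: hc; lia.
have le23 : (a2 <= a3)%N by case: hc; lia.
have [lt4 h2] : (a1%:R + a2%:R + a3%:R < a4%:R :> rat) /\
    ((a2 < a3)%N -> rho2 a1%:R a2%:R a3%:R < a4%:R).
  move: thr; rewrite /case1_threshold eqr_nat.
  case: eqP => [<-|ne] /=; first by move=> h; split; [lra | rewrite ltnn].
  by rewrite !gt_max; do 5! case/andP=> ?.
have lt4n : (a1 + a2 + a3 < a4)%N by rewrite -(ltr_nat rat) !natrD.
split; first by apply: case1_decomposes => //; lia.
move=> h; apply: case1_boij_soderberg => // d.
have [e23|ne] := eqVneq a2 a3; first exact: case1_grouped_eq.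
have lt23 : (a2 < a3)%N by rewrite ltn_neqAle ne.
apply: case1_grouped_lt => //; last 2 first.
- exact: h2.
- by case: h ne => // ->; rewrite eqxx.
- by case: hc; lia.
Qed.

Theorem theorem4p2 (a1 a2 a3 : nat)
    (a1_gt0 : (0 < a1)%N) (le12 : (a1 <= a2)%N) (le23 : (a2 <= a3)%N) :
  (* for a4 >> 0 the output depends on the degrees only, and is as listed *)
  (exists N : nat, forall a4 : nat, (N < a4)%N -> (a3 <= a4)%N ->
     exists L : decomposition,
       [/\ forall (k : fieldType) (f1 f2 f3 f4 : {mpoly k[4]}),
             complete_intersection a1 a2 a3 a4 f1 f2 f3 f4 ->
             boij_soderberg (betti_diagram (ideal_gen [:: f1; f2; f3; f4])) L,
           in_case1 a1 a2 a3 -> L = collect (case1_terms a1 a2 a3 a4)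
         & in_case2 a1 a2 a3 -> L = collect (case2_terms a1 a3 a4)])
  /\
  (* the explicit bounds on a4 *)
  (forall (k : fieldType) (a4 : nat) (f1 f2 f3 f4 : {mpoly k[4]}),
     (a3 <= a4)%N ->
     complete_intersection a1 a2 a3 a4 f1 f2 f3 f4 ->
     let beta := betti_diagram (ideal_gen [:: f1; f2; f3; f4]) in
     (in_case1 a1 a2 a3 ->
      case1_threshold a1%:R a2%:R a3%:R < a4%:R ->
      decomposes beta (case1_terms a1 a2 a3 a4) /\
      (a2 = a3 \/ 0 <= case1_y4 a1%:R a2%:R a3%:R a4%:R ->
       boij_soderberg beta (collect (case1_terms a1 a2 a3 a4))))
     /\
     (in_case2 a1 a2 a3 ->
      (maxn (2 * a1 + a3) (4 * a1) <= a4)%N ->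
      decomposes beta (case2_terms a1 a3 a4) /\
      boij_soderberg beta (collect (case2_terms a1 a3 a4)))).
Proof.
split; last first.
  move=> k a4 f1 f2 f3 f4 le34 ci beta.
  have bE : forall i j, beta i j = (koszul_betti [:: a4; a3; a2; a1] i j)%:R.
    by apply: betti_diagram_ci ci; lia.
  split=> [hc thr|[e12 lt23]]; first exact: case1_above_threshold.
  rewrite geq_max => /andP[h1 h2]; split; last exact: case2_boij_soderberg bE _ _ _.
  by apply: (@case2_decomposes a1 a2 a3 a4).
(* The quadratic term outweighs the parts of y_2 and y_4 free of [a4]; the linear term gives
   [a1 + a2 + a3 < a4] and both bounds of Case 2. *)
exists (5 * (a1 + a2 + a3) ^ 2 + 4 * (a1 + a2 + a3))%N => a4 lt4 le34.
have sum_lt4 : (a1 + a2 + a3 < a4)%N by lia.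
(* For ordered degrees, failure of the Case 2 condition is exactly Case 1. The list is fixed before
   the field and the forms are given. *)
pose terms := if (a1 == a2) && (a2 < a3)%N then case2_terms a1 a3 a4
              else case1_terms a1 a2 a3 a4.
exists (collect terms); split=> [k f1 f2 f3 f4 ci| |]; last first.
- by rewrite /terms => -[-> ->]; rewrite eqxx.
- by rewrite /terms => -[[/ltn_eqF ->]|[_ ->]]; rewrite ?ltnn ?andbF.
set b := betti_diagram _.
have bE : forall i j, b i j = (koszul_betti [:: a4; a3; a2; a1] i j)%:R.
  by apply: betti_diagram_ci ci; lia.
rewrite /terms; case: ifP => [/andP[/eqP e12 lt23]|not_case2].
  by apply: (case2_boij_soderberg a1_gt0 le12 le23 bE) => //; lia.
apply: case1_boij_soderberg => //.
have [e23|ne] := eqVneq a2 a3; first exact: case1_grouped_eq.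
have lt23 : (a2 < a3)%N by rewrite ltn_neqAle ne.
have lt12 : (a1 < a2)%N.
  by rewrite ltn_neqAle le12 andbT; move: not_case2; rewrite lt23 andbT => ->.
have q1 : 0 < a1%:R :> rat by rewrite ltr0n.
have q12 : a1%:R < a2%:R :> rat by rewrite ltr_nat.
(* Integrality gives [a3 - a1 >= 1], so the factor [x3 - x1] of [x4] in y_2 and y_4 is at least
   1. *)
have q23 : a2%:R + 1 <= a3%:R :> rat by rewrite natr1 ler_nat.
have q4 : 5 * (a1%:R + a2%:R + a3%:R) ^+ 2 < a4%:R :> rat.
  by rewrite -!natrD -natrX -natrM ltr_nat; lia.
apply: case1_grouped_lt => //; first by rewrite -!natrD ltr_nat.
all: move: q1 q12 q23 q4.
all: move: (a1%:R : rat) (a2%:R : rat) (a3%:R : rat) (a4%:R : rat).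
all: move=> x1 x2 x3 x4 q1 q12 q23 q4.
all: have p12 : 0 <= x1 * x2 by rewrite mulr_ge0 //; lra.
all: have p13 : 0 <= x1 * x3 by rewrite mulr_ge0 //; lra.
all: have p23 : 0 <= x2 * x3 by rewrite mulr_ge0 //; lra.
all: have s1 := sqr_ge0 x1; have s2 := sqr_ge0 x2; have s3 := sqr_ge0 x3.
all: have p4 : 0 <= (x3 - x1 - 1) * x4 by rewrite mulr_ge0 //; lra.
- by rewrite /rho2 ltr_pdivrMr; lra.
- by rewrite /case1_y4 -mulrN mulr_ge0 //; lra.
Qed.
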